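(* Let $(\Omega,\mathcal{F},P)$ be a probability space equipped with a filtration $(\mathcal{F}_t)_{t=0}^{T}$, where $T<\infty$ is a bounded stopping time. Let $X_T\in L^2(\Omega,\mathcal{F}_T,P)$ be a given terminal value. Define the backward recursion: set $X_T^*:=X_T$, and for $t=T-1,T-2,\ldots,0$, let $$X_t^*=\underset{Y\in L^2(\mathcal{F}_t)}{\operatorname{arg\,min}}\;E\big[(X_{t+1}^*-Y)^2\,\big|\,\mathcal{F}_t\big].$$ Then the following hold: (i) The minimizer exists, is unique (a.s.), and is given by $$X_t^*=E\big[X_{t+1}^*\mid\mathcal{F}_t\big],\qquad t=T-1,\ldots,0.$$ (ii) The process $(X_t^* )_{t=0}^{T}$ is a martingale with respect to $(\mathcal{F}_t)_{t=0}^{T}$. (iii) For every $t\in\{0,\ldots,T\}$, $$X_t^*=E\big[X_T\mid\mathcal{F}_t\big].$$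
   Context: $L^2(\mathcal{F}_t)$ denotes the space of square-integrable, $\mathcal{F}_t$-measurable real random variables on $(\Omega,\mathcal{F},P)$, and $L^2(\Omega,\mathcal{F}_T,P)$ the space of square-integrable, $\mathcal{F}_T$-measurable real random variables, where $\mathcal{F}_T$ is the sigma-algebra at the terminal time $T$. The minimization of the conditional expectation given $\mathcal{F}_t$ is understood in the almost sure sense. *)

(* Defs.v *)
(* MathComp-Analysis *)
From HB Require Import structures.
From mathcomp Require Import all_boot all_order all_algebra.
From mathcomp Require Import all_classical all_reals all_analysis.

Set Implicit Arguments.
Unset Strict Implicit.
Unset Printing Implicit Defensive.

Import Order.TTheory GRing.Theory Num.Theory.
Local Open Scope classical_set_scope.
Local Open Scope ring_scope.

Definition filtration d (Omega : measurableType d)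
    (F : nat -> set (set Omega)) : Prop :=
  [/\ forall t, sigma_algebra [set: Omega] (F t),
      forall t, F t `<=` measurable &
      forall s t, (s <= t)%N -> F s `<=` F t].

Definition stopping_time d (Omega : measurableType d)
    (F : nat -> set (set Omega)) (T : Omega -> nat) : Prop :=
  forall t, F t [set w | (T w <= t)%N].

(* The sigma-algebra F_T of a stopping time T; it is F N if T is constantly
   equal to N. *)
Definition stopping_sigma d (Omega : measurableType d)
    (F : nat -> set (set Omega)) (T : Omega -> nat) : set (set Omega) :=
  [set A | measurable A /\ forall t, F t (A `&` [set w | (T w <= t)%N])].

Definition measurable_wrt (R : realType) d (Omega : measurableType d)
    (G : set (set Omega)) (f : Omega -> R) : Prop :=
  measurable_fun setT (f : g_sigma_algebraType G -> R).

(* Elements of L2 are functions, not classes modulo almost sure equality. *)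
Definition L2 (R : realType) d (Omega : measurableType d)
    (P : probability Omega R) (G : set (set Omega)) : set (Omega -> R) :=
  [set f | measurable_wrt G f /\ f \in Lfun P 2%:E].

(* V is a version of E[Z | G]. *)
Definition is_condexp (R : realType) d (Omega : measurableType d)
    (P : probability Omega R) (G : set (set Omega)) (Z V : Omega -> R) : Prop :=
  [/\ measurable_wrt G V,
      P.-integrable setT (EFin \o V) &
      forall A, G A ->
        (\int[P]_(w in A) (V w)%:E = \int[P]_(w in A) (Z w)%:E)%E].

(* A chosen version of E[Z | G]; the default value 0 is irrelevant when Z is
   integrable and G is a sub-sigma-algebra, since a version then exists. *)
Definition condexp (R : realType) d (Omega : measurableType d)
    (P : probability Omega R) (G : set (set Omega)) (Z : Omega -> R) :
    Omega -> R :=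
  xget (cst 0) [set V | is_condexp P G Z V].

(* Y belongs to argmin_(Y' in L2(G)) E[(Z - Y')^2 | G], where the comparison
   of conditional expectations is almost sure on the event D. *)
Definition is_argmin (R : realType) d (Omega : measurableType d)
    (P : probability Omega R) (G : set (set Omega)) (D : set Omega)
    (Z Y : Omega -> R) : Prop :=
  L2 P G Y /\
  forall Y', L2 P G Y' ->
    {ae P, forall w, D w ->
      condexp P G (fun w' => (Z w' - Y w') ^+ 2) w <=
      condexp P G (fun w' => (Z w' - Y' w') ^+ 2) w}.

(* X satisfies the backward recursion with terminal value XT at time T, at all
   times t >= s. As T may be random, a process (X_t)_(t = 0..T) is represented
   by a sequence indexed by nat which keeps its terminal value after T, and the
   step at t, performed if t <= T - 1, concerns the event {t < T}. If T is
   constantly equal to N, this says that X_N = XT and that X_t is a minimizer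
   for s <= t < N. *)
Definition backward_recursion (R : realType) d (Omega : measurableType d)
    (P : probability Omega R) (F : nat -> set (set Omega)) (T : Omega -> nat)
    (XT : Omega -> R) (s : nat) (X : nat -> Omega -> R) : Prop :=
  forall t, (s <= t)%N ->
    (forall w, (T w <= t)%N -> X t w = XT w) /\
    is_argmin P (F t) [set w | (t < T w)%N] (X t.+1) (X t).

Definition martingale (R : realType) d (Omega : measurableType d)
    (P : probability Omega R) (F : nat -> set (set Omega))
    (X : nat -> Omega -> R) : Prop :=
  [/\ forall t, measurable_wrt (F t) (X t),
      forall t, P.-integrable setT (EFin \o X t) &
      forall s t, (s <= t)%N ->
        {ae P, forall w, X s w = condexp P (F s) (X t) w}].

(* Main.v *)
(* Conditional expectations exist by Radon-Nikodym on the sub-sigma-algebra G,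
   and preserve L2 by Jensen. If V is a version of E[Z | G] and Y is in L2(G),
   then Z - V is orthogonal to V - Y on every A in G, so that
     int_A (Z - Y)^2 = int_A (Z - V)^2 + int_A (V - Y)^2.
   Since int_A E[(Z - Y)^2 | G] = int_A (Z - Y)^2, letting A range over G shows
   that V is a minimizer, and A = D shows that every minimizer on the event D
   equals V almost surely on D. In the recursion, X_t = X_(t+1) = X_T on
   {T <= t}, so that X_t is a version of E[X_(t+1) | F_t] on all of Omega; the
   tower property then gives the martingale property, and the representation
   X_t = E[X_T | F_t] because X_n = X_T once n >= N. *)
Require Import Defs.
From HB Require Import structures.
From mathcomp Require Import all_boot all_order all_algebra.
From mathcomp Require Import all_classical all_reals all_analysis.
From mathcomp Require Import measurable_realfun ring lra.

Set Implicit Arguments.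
Unset Strict Implicit.
Unset Printing Implicit Defensive.

Import Order.TTheory GRing.Theory Num.Theory.
Local Open Scope classical_set_scope.
Local Open Scope ring_scope.
Import HBNNSimple numFieldNormedType.Exports.

(** * Square-integrable functions and comparison of integrals *)

Section Integrals.
Context (R : realType) d (Omega : measurableType d) (P : probability Omega R).
Implicit Types f g : Omega -> R.

Lemma Lfun2P f : f \in Lfun P 2%:E <->
  measurable_fun setT f /\ P.-integrable setT (EFin \o (fun w => f w ^+ 2)).
Proof.
split=> [fL2|[mf /integrableP[_ fi]]].
  split; last exact: Lfun2_integrable_sqr.
  by have := sub_Lfun_mfun fL2; rewrite inE.
rewrite inE; apply/andP; split; rewrite inE//= /finite_norm unlock.
apply: poweR_lty; apply: le_lt_trans fi.
rewrite le_eqVlt; apply/orP; left; apply/eqP; apply: eq_integral => w _ /=.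
by rewrite normrX powR_mulrn.
Qed.

Lemma Lfun2_integrable f : f \in Lfun P 2%:E -> P.-integrable setT (EFin \o f).
Proof.
move=> fL2; apply/Lfun1_integrable; apply: Lfun_subset12 fL2.
exact: fin_num_measure.
Qed.

Lemma Lfun2_integrableM f g : f \in Lfun P 2%:E -> g \in Lfun P 2%:E ->
  P.-integrable setT (EFin \o (f \* g)).
Proof. by move=> fL2 gL2; apply/Lfun1_integrable/Lfun2_mul_Lfun1. Qed.

Lemma Lfun2D f g : f \in Lfun P 2%:E -> g \in Lfun P 2%:E ->
  f \+ g \in Lfun P 2%:E.
Proof. by have [_] := Lfun_addr_closed P (lee1n 2); apply. Qed.

Lemma Lfun2B f g : f \in Lfun P 2%:E -> g \in Lfun P 2%:E ->
  f \- g \in Lfun P 2%:E.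
Proof.
by move=> fL2 gL2; apply: Lfun2D => //; exact: Lfun_oppr_closed.
Qed.

(** Almost everywhere on [D], [g - f] is its own absolute value, whose integral is nonnegative. *)
Lemma ae_le_integral (D : set Omega) f g :
  measurable D -> P.-integrable D (EFin \o f) -> P.-integrable D (EFin \o g) ->
  {ae P, forall w, D w -> f w <= g w} ->
  (\int[P]_(w in D) (f w)%:E <= \int[P]_(w in D) (g w)%:E)%E.
Proof.
move=> mD fi gi fg.
rewrite -sube_ge0 ?integrable_fin_num//.
have <- : (\int[P]_(w in D) `|g w - f w|%:E =
    \int[P]_(w in D) (g w)%:E - \int[P]_(w in D) (f w)%:E)%E.
  have mB : measurable_fun D (fun w => g w - f w).
    by apply: measurable_funB; apply/measurable_EFinP; apply: (measurable_int P).
  rewrite -integralB//; apply: ae_eq_integral => //.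
  - exact/measurable_EFinP/measurableT_comp.
  - exact/measurable_EFinP.
  - apply: filterS fg => w fg Dw /=.
    by rewrite ger0_norm ?subr_ge0 ?fg.
by apply: integral_ge0 => w _; rewrite lee_fin.
Qed.

End Integrals.

(** * Conditional expectation given a sub-sigma-algebra: existence and uniqueness *)

Section SubSigmaAlgebra.
Context (R : realType) d (Omega : measurableType d) (P : probability Omega R).
Variable G : set (set Omega).
Hypotheses (sG : sigma_algebra [set: Omega] G) (GM : G `<=` measurable).

Local Notation GT := (g_sigma_algebraType G).

Lemma measurable_g_sigma (A : set Omega) : G A -> measurable (A : set GT).
Proof. exact: sub_sigma_algebra. Qed.

Lemma g_sigma_measurable (A : set GT) : measurable A -> G A.
Proof. by rewrite /measurable/= sigma_algebra_id. Qed.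

Lemma measurable_wrt_preimage (f : Omega -> R) (B : set R) :
  measurable_wrt G f -> measurable B -> G (f @^-1` B).
Proof.
move=> mf mB; apply: g_sigma_measurable.
by have := mf measurableT _ mB; rewrite setTI.
Qed.

Lemma measurable_wrt_measurable (f : Omega -> R) :
  measurable_wrt G f -> measurable_fun setT f.
Proof.
move=> mf _ B mB; rewrite setTI; apply: GM.
exact: measurable_wrt_preimage.
Qed.

Lemma measurable_id_g_sigma : measurable_fun setT (id : Omega -> GT).
Proof.
move=> _ B mB; rewrite setTI; apply: GM; exact: g_sigma_measurable.
Qed.

(** [V] is the derivative of [nu] with respect to [Q]: these are the signed measure of density [Z]
    and [P], both restricted to [G] by pushing forward along the identity. *)
Lemma condexp_exists (Z : Omega -> R) :
  P.-integrable setT (EFin \o Z) -> exists V, is_condexp P G Z V.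
Proof.
move=> iZ; have mid := measurable_id_g_sigma.
pose idG : {mfun Omega >-> GT} :=
  HB.pack (id : Omega -> GT) (isMeasurableFun.Build _ _ _ _ _ mid).
pose Q : probability GT R := distribution P idG.
pose nu := measure_function_pushforward__canonical__charge_Charge
  (induced_charge iZ) mid.
have nuQ : nu `<< Q.
  apply/null_content_dominatesP => A mA QA0.
  apply: null_set_integral => //; first exact/GM/g_sigma_measurable.
  exact: measurable_funS measurableT (subsetT _) (measurable_int _ iZ).
have finf w := Radon_Nikodym_fin_num w nuQ.
have intf := Radon_Nikodym_integrable nuQ.
have fE A := @Radon_Nikodym_integral _ _ _ _ _ A nuQ.
pose f := Radon_Nikodym nu Q.
have mf := measurable_int _ intf.
(* The derivative is finite at every point by [finf], so [fine] loses nothing. *)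
pose V w := fine (f w).
have VE : EFin \o V = f by apply/funext => w /=; exact/fineK/finf.
have mV : measurable_wrt G V.
  by apply/measurable_EFinP; rewrite VE.
have intV : P.-integrable setT (EFin \o V).
  apply/integrableP; split.
    exact/measurable_EFinP/measurable_wrt_measurable.
  rewrite VE; have /integrableP[_] := intf.
  by rewrite ge0_integral_pushforward//; exact: measurableT_comp.
exists V; split => //.
move=> A GA; have mA := measurable_g_sigma GA.
transitivity (nu A); last by [].
rewrite fE// integral_pushforward//.
  by apply: eq_integral => w _; exact/fineK/finf.
suff : P.-integrable A f by [].
by rewrite -VE; apply: integrableS intV => //; exact: GM.
Qed.

(** The part [A] of [D] where [f > g] is an event of [G]. Tested on it, the hypothesis makes the
    integral of the positive function [f - g] vanish, so [A] is null. *)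
Lemma ae_le_of_integral (D : set Omega) (f g : Omega -> R) :
  G D -> measurable_wrt G f -> measurable_wrt G g ->
  P.-integrable setT (EFin \o f) -> P.-integrable setT (EFin \o g) ->
  (forall A, G A -> A `<=` D ->
    (\int[P]_(w in A) (f w)%:E <= \int[P]_(w in A) (g w)%:E)%E) ->
  {ae P, forall w, D w -> f w <= g w}.
Proof.
move=> GD mf mg fi gi fg.
pose h := f \- g.
have mh : measurable_wrt G h by exact: measurable_funB.
pose A := D `&` h @^-1` `]0, +oo[.
have GA : G A.
  apply: g_sigma_measurable; apply: measurableI; apply: measurable_g_sigma => //.
  by apply: measurable_wrt_preimage => //; exact: measurable_itv.
have mA := GM GA.
have hA w : A w -> 0 < h w by case=> _ /=; rewrite in_itv/= andbT.
have [fiA giA] : P.-integrable A (EFin \o f) /\ P.-integrable A (EFin \o g).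
  by split; apply: (integrableS measurableT).
have : (\int[P]_(w in A) `|(EFin \o h) w| = 0)%E.
  rewrite (eq_integral ((EFin \o f) \- (EFin \o g))%E); last first.
    by move=> w /set_mem /hA hw; rewrite gee0_abs ?lee_fin ?ltW.
  apply/eqP; rewrite eq_le; apply/andP; split.
    rewrite integralB// sube_le0 ?fg//.
    by apply: subIsetl.
  by apply: integral_ge0 => w /hA /ltW; rewrite lee_fin.
have mhA : measurable_fun A (EFin \o h).
  apply/measurable_EFinP/measurable_funTS.
  exact: measurable_wrt_measurable.
move/(ae_eq_integral_abs P mA mhA); apply: filterS => w hw Dw.
rewrite leNgt; apply/negP => gf.
have Aw : A w by split => //=; rewrite in_itv/= andbT subr_gt0.
by have /= [hw0] := hw Aw; have := hA _ Aw; rewrite hw0 ltxx.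
Qed.

Lemma is_condexp_condexp (Z : Omega -> R) :
  P.-integrable setT (EFin \o Z) -> is_condexp P G Z (condexp P G Z).
Proof. by move=> /condexp_exists hZ; rewrite /condexp; exact: (xgetPex _ hZ). Qed.

Lemma is_condexp_ae_unique (Z V V' : Omega -> R) :
  is_condexp P G Z V -> is_condexp P G Z V' -> {ae P, forall w, V w = V' w}.
Proof.
move=> [mV iV EV] [mV' iV' EV'].
have GT0 : G setT by apply: g_sigma_measurable; exact: measurableT.
have h1 : {ae P, forall w, setT w -> V w <= V' w}.
  by apply: ae_le_of_integral => // A GA _; rewrite EV// EV'.
have h2 : {ae P, forall w, setT w -> V' w <= V w}.
  by apply: ae_le_of_integral => // A GA _; rewrite EV// EV'.
by apply: filterS2 h1 h2 => w l1 l2; apply/eqP; rewrite eq_le l1// l2.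
Qed.

(** * Orthogonality and the conditional Jensen inequality *)

(** Orthogonality to events of [G] extends to simple functions by linearity, then to nonnegative [W]
    by dominated convergence with bound [|W * U|]. *)
Lemma ge0_integral_mul_eq0 (A : set Omega) (W U : Omega -> R) :
  G A -> measurable_wrt G W -> (forall w, 0 <= W w) ->
  P.-integrable setT (EFin \o U) -> P.-integrable setT (EFin \o (W \* U)) ->
  (forall B, G B -> (\int[P]_(w in B) (U w)%:E = 0)%E) ->
  (\int[P]_(w in A) (W w * U w)%:E = 0)%E.
Proof.
move=> GA mW W0 iU iWU U0; have mA := GM GA.
have mWE : measurable_fun (setT : set GT) (EFin \o W) by exact/measurable_EFinP.
(* The approximation is taken on the type carrying [G], so that the level sets of each [phi n] are
   events of [G]. *)
pose phi := nnsfun_approx measurableT mWE.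
have phicvg (w : Omega) : phi ^~ w @ \oo --> W w.
  have W0E (v : GT) : [set: GT] v -> (0 <= (EFin \o W) v)%E by rewrite lee_fin.
  have /fine_cvgP[_] := cvg_nnsfun_approx measurableT mWE W0E (I : [set: GT] w).
  exact.
have phile n (w : Omega) : phi n w <= W w.
  rewrite -(cvg_lim _ (phicvg w))//.
  apply: (@nondecreasing_cvgn_le _ (phi ^~ w)).
    by move=> m k mk; have /lefP := nd_nnsfun_approx measurableT mWE mk; apply.
  by apply/cvg_ex; exists (W w); exact: phicvg.
have phim n : measurable_wrt G (phi n) by exact: measurable_funP.
have mU : measurable_fun setT U by exact/measurable_EFinP/(measurable_int P).
have mphi n : measurable_fun setT (phi n : Omega -> R).
  exact: measurable_wrt_measurable (phim n).
have phige0 n (w : Omega) : 0 <= phi n w by [].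
have phi0 n : (\int[P]_(w in A) (phi n w * U w)%:E = 0)%E.
  pose B s := phi n @^-1` [set s] : set Omega.
  have GB s : G (B s) by exact: measurable_wrt_preimage (phim n) _.
  have termE s (w : Omega) :
    (s * \1_(B s) w * U w)%:E = (s%:E * ((EFin \o U) \_ (B s)) w)%E.
    by rewrite epatch_indic -!EFinM mulrA mulrAC.
  have iUB s : P.-integrable A ((EFin \o U) \_ (B s)).
    apply/integrable_restrict => //; first exact: GM.
    by apply: integrableS iU => //; apply: measurableI => //; exact: GM.
  (* [phi n] is the sum of its values [s] times the indicators of the [B s]; each term reduces to an
     integral of [U] over an event of [G]. *)
  under eq_integral.
    move=> w _; rewrite (fimfunEord (phi n)) mulr_suml -sumEFin.
    under eq_bigr do rewrite termE.
    over.
  rewrite integral_sum//; last by move=> i; exact: integrableZl.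
  rewrite big1// => i _; rewrite integralZl// -integral_mkcondr U0 ?mule0//.
  apply: g_sigma_measurable; apply: measurableI; exact: measurable_g_sigma.
have domcvg n w : (`|(phi n w * U w)%:E| <= (`|(W w * U w)%:E|))%E.
  by rewrite lee_fin !normrM ler_wpM2r// !ger0_norm.
have [] := @dominated_convergence _ _ _ P A mA
  (fun n w => (phi n w * U w)%:E) (EFin \o (W \* U)) (abse \o (EFin \o (W \* U))).
- move=> n; apply/measurable_EFinP/measurable_funTS.
  exact: measurable_funM.
- apply/measurable_EFinP/measurable_funTS/measurable_funM => //.
  exact: measurable_wrt_measurable.
- apply: aeW => w _; apply: cvg_EFin; first exact: nearW.
  by apply: cvgM; [exact: phicvg|exact: cvg_cst].
- by apply: integrable_abse; apply: integrableS iWU.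
- exact: aeW.
move=> _ _ /=.
under eq_fun do rewrite phi0.
by move=> /cvg_lim <-//; rewrite lim_cst.
Qed.

(** Both parts of [W] are bounded by [|W|], so their products with [U] stay integrable. *)
Lemma integral_mul_eq0 (A : set Omega) (W U : Omega -> R) :
  G A -> measurable_wrt G W ->
  P.-integrable setT (EFin \o U) -> P.-integrable setT (EFin \o (W \* U)) ->
  (forall B, G B -> (\int[P]_(w in B) (U w)%:E = 0)%E) ->
  (\int[P]_(w in A) (W w * U w)%:E = 0)%E.
Proof.
move=> GA mW iU iWU U0; have mA := GM GA.
have mU : measurable_fun setT U by exact/measurable_EFinP/(measurable_int P).
have mWp : measurable_wrt G (W^\+) by exact: measurable_funrpos.
have mWn : measurable_wrt G (W^\-) by exact: measurable_funrneg.
have WE w : W w = W^\+ w - W^\- w by rewrite -{1}[W]funrposBneg.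
have normE w : `|W w| = W^\+ w + W^\- w.
  by rewrite -[RHS]/((W^\+ + W^\-) w) funrposDneg.
have ip : P.-integrable setT (EFin \o (W^\+ \* U)).
  apply: le_integrable iWU => //.
    by apply/measurable_EFinP/measurable_funM => //; exact: measurable_wrt_measurable.
  move=> w _ /=; rewrite lee_fin !normrM ler_wpM2r//.
  by rewrite normE ger0_norm ?funrpos_ge0// lerDl funrneg_ge0.
have ineg : P.-integrable setT (EFin \o (W^\- \* U)).
  apply: le_integrable iWU => //.
    by apply/measurable_EFinP/measurable_funM => //; exact: measurable_wrt_measurable.
  move=> w _ /=; rewrite lee_fin !normrM ler_wpM2r//.
  by rewrite normE ger0_norm ?funrneg_ge0// lerDr funrpos_ge0.
under eq_integral do rewrite WE mulrBl EFinB.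
rewrite integralB//.
- by rewrite !ge0_integral_mul_eq0 ?subee.
- exact: integrableS ip.
- exact: integrableS ineg.
Qed.

(** Conditional Jensen for the square: almost surely [V ^+ 2 <= C], with [C] a version of the
    conditional expectation of [Z ^+ 2], which is integrable. *)
Lemma is_condexp_L2 (Z V : Omega -> R) :
  Z \in Lfun P 2%:E -> is_condexp P G Z V -> L2 P G V.
Proof.
move=> ZL2 [mV iV EV]; split => //.
have iZ2 := Lfun2_integrable_sqr ZL2; have iZ := Lfun2_integrable ZL2.
set C := condexp P G (fun w => Z w ^+ 2).
have [mC iC EC] : is_condexp P G (fun w => Z w ^+ 2) C by exact: is_condexp_condexp.
have GTT : G setT by apply: g_sigma_measurable; exact: measurableT.
(* [z ^+ 2] is the supremum of its tangents [2 * a * z - a ^+ 2], [a] rational. *)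
have tangent (a : R) : {ae P, forall w, setT w -> 2 * a * V w - a ^+ 2 <= C w}.
  have i_lin (X : Omega -> R) : P.-integrable setT (EFin \o X) ->
      P.-integrable setT (EFin \o (fun w => 2 * a * X w - a ^+ 2)).
    move=> iX.
    have -> : EFin \o (fun w => 2 * a * X w - a ^+ 2) =
        ((fun w => (2 * a)%:E * (EFin \o X) w) \- cst (a ^+ 2)%:E)%E.
      by apply/funext => w; rewrite /= EFinB EFinM.
    apply: integrableB => //; first exact: integrableZl.
    exact: finite_measure_integrable_cst.
  apply: ae_le_of_integral => //.
  - apply: measurable_funB => //; exact: measurable_funM.
  - exact: i_lin.
  move=> A GA _; have mA := GM GA.
  have E_lin (X : Omega -> R) : P.-integrable setT (EFin \o X) ->
      (\int[P]_(w in A) (2 * a * X w - a ^+ 2)%:E =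
       (2 * a)%:E * \int[P]_(w in A) (X w)%:E - (a ^+ 2)%:E * P A)%E.
    move=> iX; under eq_integral do rewrite EFinB EFinM.
    rewrite integralB//.
    - rewrite integralZl ?integral_cst//.
      exact: integrableS iX.
    - by apply: integrableZl => //; exact: integrableS iX.
    - exact: finite_measure_integrable_cst.
  (* Linearity exchanges [V] for [Z], and [EC] exchanges [C] for [Z ^+ 2]; what remains follows from
     [0 <= (Z - a) ^+ 2]. *)
  rewrite E_lin// EV// -E_lin// EC//.
  apply: le_integral => //.
  - by apply: integrableS (i_lin _ iZ).
  - by apply: integrableS iZ2.
  - move=> w _; rewrite lee_fin; have := sqr_ge0 (Z w - a); lra.
(* Enumerating the rationals lets one null set serve all the tangents. *)
pose q n : R := if unpickle n is Some r then ratr r else 0.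
have VC : {ae P, forall w, V w ^+ 2 <= C w}.
  have := @ae_foralln _ _ _ P _ (fun n => tangent (q n)).
  apply: filterS => w h; rewrite leNgt; apply/negP => CV.
  (* The tangent at a rational [r] within [e] of [V w] has value [V w ^+ 2 - (V w - r) ^+ 2], above
     [V w ^+ 2 - e ^+ 2]. As [e <= 1] gives [e ^+ 2 <= e], this exceeds [C w]. *)
  pose e := Num.min 1 (V w ^+ 2 - C w).
  have e0 : 0 < e by rewrite lt_min ltr01 subr_gt0.
  have e1 : e <= 1 by rewrite ge_min lexx.
  have eV : e <= V w ^+ 2 - C w by rewrite ge_min lexx orbT.
  have [r] : exists r : rat, ratr r \in `]V w - e, V w + e[.
    by apply: rat_in_itvoo; lra.
  rewrite in_itv/= => /andP[r1 r2].
  have := h (pickle r) I; rewrite /q pickleK.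
  nra.
have mV' := measurable_wrt_measurable mV.
apply/Lfun2P; split => //.
apply/integrableP; split; first exact/measurable_EFinP/measurable_funX.
have /integrableP[mC'] := iC; apply: le_lt_trans.
apply: ae_ge0_le_integral => //.
- exact/measurableT_comp/measurable_EFinP/measurable_funX.
- exact: measurableT_comp.
- apply: filterS VC => w h _; rewrite /= lee_fin ger0_norm ?sqr_ge0//.
  exact: le_trans h (ler_norm _).
Qed.

(** * Minimizers of the conditional mean square error *)

(** Pythagoras on [A]: the cross term multiplies [V - Y], measurable for [G], by [Z - V], whose
    integral over every event of [G] is zero. *)
Lemma integral_sqrB_condexp (A : set Omega) (Z V Y : Omega -> R) :
  G A -> Z \in Lfun P 2%:E -> is_condexp P G Z V -> L2 P G Y ->
  (\int[P]_(w in A) ((Z w - Y w) ^+ 2)%:E =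
   \int[P]_(w in A) ((Z w - V w) ^+ 2)%:E +
   \int[P]_(w in A) ((V w - Y w) ^+ 2)%:E)%E.
Proof.
move=> GA ZL2 hV [mY YL2]; have [mV VL2] := is_condexp_L2 ZL2 hV.
have mA := GM GA.
have [_ _ EV] := hV.
have [ZV VY] := (Lfun2B ZL2 VL2, Lfun2B VL2 YL2).
have iZV2 : P.-integrable A (EFin \o (fun w => (Z w - V w) ^+ 2)).
  by apply: integrableS (Lfun2_integrable_sqr ZV).
have iVY2 : P.-integrable A (EFin \o (fun w => (V w - Y w) ^+ 2)).
  by apply: integrableS (Lfun2_integrable_sqr VY).
have iVYZV := Lfun2_integrableM VY ZV.
have iVYZVA : P.-integrable A (EFin \o ((V \- Y) \* (Z \- V))).
  by apply: integrableS iVYZV.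
have cross : (\int[P]_(w in A) ((V w - Y w) * (Z w - V w))%:E = 0)%E.
  apply: (integral_mul_eq0 GA _ (Lfun2_integrable ZV) iVYZV).
    exact: measurable_funB.
  move=> B GB; have mB := GM GB.
  under eq_integral do rewrite EFinB.
  rewrite integralB//; [|by apply: integrableS (Lfun2_integrable _)..].
  by rewrite EV// subee// -EV// integrable_fin_num//; apply: integrableS (Lfun2_integrable VL2).
transitivity (\int[P]_(w in A) (((Z w - V w) ^+ 2)%:E + ((V w - Y w) ^+ 2)%:E +
   2%:E * ((V w - Y w) * (Z w - V w))%:E))%E.
  by apply: eq_integral => w _; rewrite -EFinM -!EFinD; congr EFin; ring.
rewrite integralD//; [|exact: integrableD|exact: integrableZl].
by rewrite integralZl// cross mule0 adde0 integralD.
Qed.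

Lemma integrable_sqrB (Z Y : Omega -> R) :
  Z \in Lfun P 2%:E -> L2 P G Y ->
  P.-integrable setT (EFin \o (fun w => (Z w - Y w) ^+ 2)).
Proof. by move=> ZL2 [_ YL2]; apply: Lfun2_integrable_sqr; exact: Lfun2B. Qed.

Lemma is_condexp_is_argmin (D : set Omega) (Z V : Omega -> R) :
  G D -> Z \in Lfun P 2%:E -> is_condexp P G Z V -> is_argmin P G D Z V.
Proof.
move=> GD ZL2 hV; have VL2 := is_condexp_L2 ZL2 hV; split=> // Y YL2.
have [mCV iCV ECV] := is_condexp_condexp (integrable_sqrB ZL2 VL2).
have [mCY iCY ECY] := is_condexp_condexp (integrable_sqrB ZL2 YL2).
apply: ae_le_of_integral => // A GA _; rewrite ECV// ECY//.
rewrite (integral_sqrB_condexp GA ZL2 hV YL2) leeDl//.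
by apply: integral_ge0 => w _; rewrite lee_fin sqr_ge0.
Qed.

(** Integrating the comparison with [V] over [D] and cancelling the finite error of [V] leaves an
    integral of [(V - Y) ^+ 2] that is at most zero. *)
Lemma is_argmin_ae_eq (D : set Omega) (Z V Y : Omega -> R) :
  G D -> Z \in Lfun P 2%:E -> is_condexp P G Z V -> is_argmin P G D Z Y ->
  {ae P, forall w, D w -> Y w = V w}.
Proof.
move=> GD ZL2 hV [YL2 Ymin]; have VL2 := is_condexp_L2 ZL2 hV.
have mD := GM GD.
have iV := integrable_sqrB ZL2 VL2.
have [mCV iCV ECV] := is_condexp_condexp iV.
have [mCY iCY ECY] := is_condexp_condexp (integrable_sqrB ZL2 YL2).
have : (\int[P]_(w in D) ((Z w - Y w) ^+ 2)%:E <=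
        \int[P]_(w in D) ((Z w - V w) ^+ 2)%:E)%E.
  rewrite -ECV// -ECY//; apply: ae_le_integral => //.
  - exact: integrableS iCY.
  - exact: integrableS iCV.
  - exact: Ymin.
rewrite (integral_sqrB_condexp GD ZL2 hV YL2) -[leRHS]adde0 leeD2lE.
  2: by rewrite integrable_fin_num//; exact: integrableS iV.
move=> VY0.
have {VY0} : (\int[P]_(w in D) `|((V w - Y w) ^+ 2)%:E| = 0)%E.
  under eq_integral do rewrite gee0_abs ?lee_fin ?sqr_ge0//.
  apply/eqP; rewrite eq_le VY0 integral_ge0// => w _.
  by rewrite lee_fin sqr_ge0.
have mVY : measurable_fun D (fun w => ((V w - Y w) ^+ 2)%:E).
  apply/measurable_EFinP/measurable_funX/measurable_funTS/measurable_funB;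
    apply: measurable_wrt_measurable; [exact: VL2.1|exact: YL2.1].
move/(ae_eq_integral_abs P mD mVY); apply: filterS => w h /h [] /eqP.
by rewrite sqrf_eq0 subr_eq0 => /eqP.
Qed.

(** Minimality determines a step of the recursion only on [D]. Each event is split along [D]:
    inside, [V] replaces [Y]; outside, [Y] is [Z] itself. *)
Lemma is_condexp_glue (D : set Omega) (Z V Y : Omega -> R) :
  G D -> P.-integrable setT (EFin \o Z) -> is_condexp P G Z V ->
  measurable_wrt G Y -> P.-integrable setT (EFin \o Y) ->
  {ae P, forall w, D w -> Y w = V w} -> (forall w, ~ D w -> Y w = Z w) ->
  is_condexp P G Z Y.
Proof.
move=> GD iZ [mV iV EV] mY iY YV YZ; split=> // A GA.
have [mA mD] := (GM GA, GM GD).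
have mAD : measurable (A `&` D) by exact: measurableI.
have GAD : G (A `&` D).
  by apply: g_sigma_measurable; apply: measurableI; exact: measurable_g_sigma.
have split_int (f : Omega -> R) : P.-integrable setT (EFin \o f) ->
    (\int[P]_(w in A) (f w)%:E =
     \int[P]_(w in A `&` D) (f w)%:E + \int[P]_(w in A `\` D) (f w)%:E)%E.
  move=> fi; rewrite -integral_setU//.
  - by rewrite setUIDK.
  - exact: measurableD.
  - by rewrite setUIDK; exact: measurable_funS measurableT _ (measurable_int P fi).
  - by rewrite disj_set2E; apply/eqP/seteqP; split=> // w [[_ Dw] [_]].
rewrite !split_int//; congr (_ + _)%E.
  rewrite -EV//; apply: ae_eq_integral => //.
  - exact/measurable_EFinP/measurable_funTS/measurable_wrt_measurable.
  - exact/measurable_EFinP/measurable_funTS/measurable_wrt_measurable.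
  - by apply: filterS YV => w h [_ Dw] /=; rewrite h.
by apply: eq_integral => w /set_mem [_ nD]; rewrite YZ.
Qed.

End SubSigmaAlgebra.

(** * Tower property *)

Lemma is_condexp_tower (R : realType) d (Omega : measurableType d)
    (P : probability Omega R) (G H : set (set Omega)) (X Y Z : Omega -> R) :
  G `<=` H -> is_condexp P H X Y -> is_condexp P G Y Z -> is_condexp P G X Z.
Proof.
move=> GH [_ _ EY] [mZ iZ EZ]; split=> // A GA.
by rewrite EZ// EY//; exact: GH.
Qed.

(** [X] and [Y] have the same integrals over events of [G]. This serves to check that the closed
    form satisfies the recursion. *)
Lemma is_condexp_of_finer (R : realType) d (Omega : measurableType d)
    (P : probability Omega R) (G H : set (set Omega)) (X Y Z : Omega -> R) :
  G `<=` H -> is_condexp P H X Y -> is_condexp P G X Z -> is_condexp P G Y Z.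
Proof.
move=> GH [_ _ EY] [mZ iZ EZ]; split=> // A GA.
by rewrite EZ// EY//; exact: GH.
Qed.

(** * The backward recursion along a stopping time *)

Section StoppedProcess.
Context (R : realType) d (Omega : measurableType d) (P : probability Omega R).
Variables (F : nat -> set (set Omega)) (T : Omega -> nat).
Variable XT : Omega -> R.
Hypotheses (hF : filtration F) (hT : stopping_time F T).
Hypothesis hXT : L2 P (stopping_sigma F T) XT.

Let sF t : sigma_algebra [set: Omega] (F t). Proof. by case: hF. Qed.
Let FM t : F t `<=` measurable. Proof. by case: hF. Qed.
Let Fmono s t : (s <= t)%N -> F s `<=` F t. Proof. by case: hF => _ _; apply. Qed.

(** [measurable_wrt] refers to a generated sigma-algebra; this brings preimages under [XT] back to
    [stopping_sigma F T], where membership unfolds. *)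
Lemma stopping_sigmaP : sigma_algebra [set: Omega] (stopping_sigma F T).
Proof.
split.
- split=> [//|t]; rewrite set0I; by have [] := sF t.
- move=> A [mA FA]; split; first by rewrite setTD; exact: measurableC.
  move=> t; have [_ FC _] := sF t.
  have -> : ([set: Omega] `\` A) `&` [set w | (T w <= t)%N] =
      [set w | (T w <= t)%N] `\` (A `&` [set w | (T w <= t)%N]).
    apply/seteqP; split=> w /= [].
      by move=> [_ nA] Tw; split => // -[].
    by move=> Tw nA; split=> //; split=> // Aw; apply: nA.
  apply: (g_sigma_measurable (sF t)); apply: measurableD;
    apply: measurable_g_sigma; [exact: hT|exact: FA].
- move=> A FA; split; first by apply: bigcup_measurable => k _; have [] := FA k.
  move=> t; rewrite setI_bigcupl; have [_ _ FU] := sF t.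
  by apply: FU => k; have [_] := FA k.
Qed.

Lemma before_stopping t : F t [set w | (t < T w)%N].
Proof.
have [_ FC _] := sF t; have -> : [set w | (t < T w)%N] =
  [set: Omega] `\` [set w | (T w <= t)%N].
  apply/seteqP; split=> w /=; rewrite ltnNge; first by move/negP.
  by move=> [_ /negP].
exact: FC.
Qed.

(** By definition of [stopping_sigma], events of [XT] cut down to [T <= t] belong to [F t]. *)
Lemma measurable_wrt_stopped (V : Omega -> R) t : measurable_wrt (F t) V ->
  measurable_wrt (F t) (fun w => if (T w <= t)%N then XT w else V w).
Proof.
move=> mV; apply: measurable_fun_if => //.
- apply: (@measurable_fun_bool _ _ _ _ true).
  by rewrite setTI; apply: measurable_g_sigma; exact: (hT t).
- move=> _ B mB; rewrite setTI; apply: measurable_g_sigma.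
  have [_] := measurable_wrt_preimage stopping_sigmaP hXT.1 mB.
  by move/(_ t); rewrite setIC.
- exact: measurable_funTS.
Qed.

(** The solution is [condexp P (F t) XT], overwritten by [XT] where [T <= t]: there the recursion
    demands equality at every point, not just almost surely. *)
Lemma backward_recursion_exists : exists X, backward_recursion P F T XT 0 X.
Proof.
have [mXT XT2] := hXT.
have iXT := Lfun2_integrable XT2.
have hV t := is_condexp_condexp (sF t) (@FM t) iXT.
(* With this closed form of the solution, no recursion on t is needed. *)
pose X t w := if (T w <= t)%N then XT w else condexp P (F t) XT w.
have mX t : measurable_wrt (F t) (X t).
  by apply: measurable_wrt_stopped; have [] := hV t.
have X2 t : X t \in Lfun P 2%:E.
  have [mV /Lfun2P[_ iV2]] := is_condexp_L2 (sF t) (@FM t) XT2 (hV t).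
  have /Lfun2P[mXT' iXT2] := XT2.
  have mX' := measurable_wrt_measurable (sF t) (@FM t) (mX t).
  apply/Lfun2P; split => //.
  apply: le_integrable (integrableD _ iXT2 iV2) => //.
    exact/measurable_EFinP/measurable_funX.
  move=> w _ /=; rewrite lee_fin !ger0_norm ?addr_ge0 ?sqr_ge0//.
  by rewrite /X; case: ifP => _; rewrite ?lerDl ?lerDr sqr_ge0.
have hX t : is_condexp P (F t) XT (X t).
  apply: (is_condexp_glue (sF t) (@FM t) (before_stopping t) iXT (hV t)) => //.
  - exact: Lfun2_integrable.
  - by apply: aeW => w /= tT; rewrite /X leqNgt tT.
  - by move=> w /= /negP; rewrite -leqNgt /X => ->.
exists X => t _; split=> [w Tw|]; first by rewrite /X Tw.
apply: (is_condexp_is_argmin (sF t) (@FM t)) => //; first exact: before_stopping.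
exact: is_condexp_of_finer (Fmono (leqnSn t)) (hX t.+1) (hX t).
Qed.

Lemma backward_recursion_L2 s X t : backward_recursion P F T XT s X ->
  (s <= t)%N -> L2 P (F t) (X t).
Proof. by move=> hX /hX[_ []]. Qed.

Lemma backward_recursion_condexp X t : backward_recursion P F T XT 0 X ->
  is_condexp P (F t) (X t.+1) (X t).
Proof.
move=> hX.
have [mX X2] := backward_recursion_L2 hX (leq0n t).
have [_ XS2] := backward_recursion_L2 hX (leq0n t.+1).
have iXS := Lfun2_integrable XS2.
have hV := is_condexp_condexp (sF t) (@FM t) iXS.
have [XTt Xmin] := hX t (leq0n t).
apply: (is_condexp_glue (sF t) (@FM t) (before_stopping t) iXS hV) => //.
- exact: Lfun2_integrable.
- by have := is_argmin_ae_eq (sF t) (@FM t) (before_stopping t) XS2 hV Xmin.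
- move=> w /= /negP; rewrite -leqNgt => Tt; rewrite XTt//.
  by have [->//] := hX t.+1 (leq0n _); exact: leqW.
Qed.

Lemma backward_recursion_tower X s t : backward_recursion P F T XT 0 X ->
  (s <= t)%N -> is_condexp P (F s) (X t) (X s).
Proof.
(* Induction on the gap between [s] and [t]; in the base case [X s] is a version of its own
   conditional expectation. *)
move=> hX /subnK <-; elim: (t - s)%N => [|k IH].
  have [mX X2] := backward_recursion_L2 hX (leq0n s).
  by split=> //; exact: Lfun2_integrable.
apply: is_condexp_tower (Fmono (leq_addl k s)) _ IH.
exact: backward_recursion_condexp.
Qed.

End StoppedProcess.

(** * Minimizers, existence of the process, martingale representation *)

(** The first clause takes a process that solves the recursion from [t.+1] on, so that a minimizer
    at [t] is not presupposed. *)
Theorem lemma2 (R : realType) (d : measure_display) (Omega : measurableType d)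
    (P : probability Omega R) (F : nat -> set (set Omega)) (T : Omega -> nat)
    (N : nat) (XT : Omega -> R)
    (hF : filtration F) (hT : stopping_time F T)
    (hTN : forall w, (T w <= N)%N)
    (hXT : L2 P (stopping_sigma F T) XT) :
  (* at each step t <= T - 1, the minimizer exists, is a.s. unique, and is the
     conditional expectation *)
  (forall (t : nat) (X : nat -> Omega -> R),
     backward_recursion P F T XT t.+1 X ->
     let argmin := is_argmin P (F t) [set w | (t < T w)%N] (X t.+1) in
     [/\ exists Y, argmin Y,
         forall Y Y', argmin Y -> argmin Y' ->
           {ae P, forall w, (t < T w)%N -> Y w = Y' w} &
         forall Y, argmin Y ->
           {ae P, forall w, (t < T w)%N ->
             Y w = condexp P (F t) (X t.+1) w}]) /\
  (exists X, backward_recursion P F T XT 0 X) /\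
  (forall X, backward_recursion P F T XT 0 X ->
     [/\ forall t, {ae P, forall w, (t < T w)%N ->
           X t w = condexp P (F t) (X t.+1) w},
         martingale P F X &
         forall t, {ae P, forall w, (t <= T w)%N ->
           X t w = condexp P (F t) XT w}]).
Proof.
have [sF FM Fmono] := hF.
have condexpE t X Z : P.-integrable setT (EFin \o Z) ->
    is_condexp P (F t) Z X -> {ae P, forall w, X w = condexp P (F t) Z w}.
  move=> iZ hX; have hZ := is_condexp_condexp (sF t) (FM t) iZ.
  by have := is_condexp_ae_unique (sF t) (FM t) hX hZ.
split; [|split].
- move=> t X hX argmin.
  have [_ X2] := backward_recursion_L2 hX (leqnn t.+1).
  have hD := before_stopping hF hT t.
  have hV := is_condexp_condexp (sF t) (FM t) (Lfun2_integrable X2).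
  have argminE Y : argmin Y ->
      {ae P, forall w, (t < T w)%N -> Y w = condexp P (F t) (X t.+1) w}.
    by move=> hY; have := is_argmin_ae_eq (sF t) (FM t) hD X2 hV hY.
  split=> // [|Y Y' /argminE hY /argminE hY'].
    by exists (condexp P (F t) (X t.+1)); exact: is_condexp_is_argmin.
  by apply: filterS2 hY hY' => w + + Tw => -> // ->.
- exact: backward_recursion_exists.
- move=> X hX.
  have XL2 t := backward_recursion_L2 hX (leq0n t).
  have iX t := Lfun2_integrable (XL2 t).2.
  have tower s t : (s <= t)%N -> is_condexp P (F s) (X t) (X s).
    exact: (backward_recursion_tower hF hT hX).
  split.
  + move=> t; have := condexpE _ _ _ (iX t.+1) (tower _ _ (leqnSn t)).
    by apply: filterS => w ->.
  + split=> // [t|s t st]; first by have [] := XL2 t.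
    exact: condexpE (tower _ _ st).
  (* From index [N] on, [X] equals [XT] everywhere; the maximum with [t] keeps the index late enough
     for the tower property. *)
  + move=> t; have -> : XT = X (maxn t N).
      apply/funext => w; have [->//] := hX (maxn t N) (leq0n _).
      by rewrite (leq_trans (hTN w))// leq_maxr.
    have := condexpE _ _ _ (iX _) (tower t (maxn t N) (leq_maxl _ _)).
    by apply: filterS => w ->.
Qed.
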